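(* Consider the randomized gossip model described in the context and assume A1, A2 and A4. Assume that either $T_{k+1}\le T_k$ for all $k$, or $T_{k+1}\ge T_k$ for all $k$. If $$\sum_{k=0}^\infty \big((1-T_k)T_k\big)^{n-1}=\infty,$$ then global agreement convergence is achieved almost surely, i.e. $\mathbf P(\limsup_{k\to\infty}\mathcal H(k)=0)=1$ for all initial times and initial values.
   Context: Network with node set $\mathcal V=\{1,\dots,n\}$, $n\ge 3$. Let $A=[a_{ij}]$ be an $n\times n$ stochastic matrix; the underlying digraph $\mathcal G_0$ has an arc $(j,i)$ iff $a_{ij}>0$. At each time $k=0,1,2,\dots$, independently of the past and of node states, a node $i$ is drawn with probability $1/n$ and then the pair $(i,j)$ is selected with probability $a_{ij}$. Given that pair $(i,j)$ is selected at time $k$, independently of time, node states and pair selection, node $i$: with probability $\alpha$ (event $\mathscr A_{ij}(k)$) sets $x_i(k+1)=(1-T_k)x_i(k)+T_kx_j(k)$, $0<T_k\le1$; with probability $\beta$ (event $\mathscr N_{ij}(k)$) keeps its state; with probability $\gamma$ (event $\mathscr R_{ij}(k)$) sets $x_i(k+1)=(1+S_k)x_i(k)-S_kx_j(k)$, $S_k>0$; $\alpha+\beta+\gamma=1$. Node $j$ updates analogously according to events $\mathscr A_{ji}(k),\mathscr N_{ji}(k),\mathscr R_{ji}(k)$; other nodes keep their states. Start at time $k_0\ge0$ from $x(k_0)\in\mathbb R^n$. $\mathcal H(k)=\max_i x_i(k)-\min_i x_i(k)$. A1: $\mathcal G_0$ is weakly connected. A2: $\mathscr R_{ij}(k)$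 has probability zero for all $(i,j)$, $k$. A4: $\mathscr A_{ij}(k)\cap\mathscr A_{ji}(k)$ has probability zero for all $(i,j)$, $k$.
   Formalization: The formal theorem adds the assumption α > 0; with α = 0, A2 gives γ = 0 and β = 1, so no node ever changes its state and agreement fails for every non-constant initial value. *)

(* Defs.v *)
From HB Require Import structures.
From mathcomp Require Import all_boot all_order all_algebra.
From mathcomp Require Import all_classical all_reals all_analysis.
Set Implicit Arguments. Unset Strict Implicit. Unset Printing Implicit Defensive.
Import Order.TTheory GRing.Theory Num.Theory.
Local Open Scope classical_set_scope.
Local Open Scope ring_scope.

(* The three possible node events: attraction (A), neglect (N), repulsion (R). *)
Inductive node_event := EvA | EvN | EvR.

(* The random outcome drawn at one time step: the ordered pair (i,j)
   (i the node drawn uniformly, j its partner), the event for node i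
   (A_ij / N_ij / R_ij) and the event for node j (A_ji / N_ji / R_ji). *)
Definition outcome (n : nat) : Type := ('I_n * 'I_n * node_event * node_event)%type.

(* Law of one step: P(i,j,e_i,e_j) = (1/n) * a_ij * q(e_i,e_j),
   where q is the (time- and pair-independent) joint law of the two node events. *)
Definition step_law (R : realType) (n : nat) (a : 'M[R]_n)
  (q : node_event -> node_event -> R) (o : outcome n) : R :=
  let: (i, j, ei, ej) := o in (n%:R)^-1 * a i j * q ei ej.

Definition stochastic (R : realType) (n : nat) (a : 'M[R]_n) : Prop :=
  (forall i j, 0 <= a i j) /\ (forall i, \sum_j a i j = 1).

(* A1: the digraph G_0 (arc (j,i) iff a_ij > 0) is weakly connected, i.e. its
   underlying undirected graph is connected. *)
Definition weakly_connected (R : realType) (n : nat) (a : 'M[R]_n) : Prop :=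
  forall i j : 'I_n, connect (fun u v : 'I_n => (0 < a u v) || (0 < a v u)) i j.

Definition iid_seq (R : realType) (d : measure_display) (Omega : measurableType d)
  (P : probability Omega R) (O : Type) (p : O -> R) (X : nat -> Omega -> O) : Prop :=
  (forall k o, measurable [set w : Omega | X k w = o]) /\
  (forall (N : nat) (o : nat -> O),
      P [set w : Omega | forall k : nat, (k < N)%N -> X k w = o k] = (\prod_(k < N) p (o k))%:E).

Definition node_update (R : realType) (e : node_event) (Tk Sk xi xj : R) : R :=
  match e with
  | EvA => (1 - Tk) * xi + Tk * xj
  | EvN => xi
  | EvR => (1 + Sk) * xi - Sk * xj
  end.

Definition gossip_step (R : realType) (n : nat) (Tk Sk : R) (o : outcome n)
  (x : 'I_n -> R) : 'I_n -> R :=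
  let: (i, j, ei, ej) := o in
  fun l => if l == i then node_update ei Tk Sk (x i) (x j)
           else if l == j then node_update ej Tk Sk (x j) (x i)
           else x l.

(* traj k0 x0 m w = x(k0 + m) along the sample w, started at time k0 from x0. *)
Fixpoint traj (R : realType) (n : nat) (T S : nat -> R) (Omega : Type)
  (X : nat -> Omega -> outcome n) (k0 : nat) (x0 : 'I_n -> R) (m : nat)
  (w : Omega) : 'I_n -> R :=
  match m with
  | O => x0
  | m'.+1 => gossip_step (T (k0 + m')%N) (S (k0 + m')%N) (X (k0 + m')%N w)
                         (traj T S X k0 x0 m' w)
  end.

(* H(x) = max_i x_i - min_i x_i, written as max_{i,j} (x_i - x_j)
   (0 is a valid seed for the max since x_i - x_i = 0). *)
Definition Hgap (R : realType) (n : nat) (x : 'I_n -> R) : R :=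
  \big[Num.max/0]_(i < n) \big[Num.max/0]_(j < n) (x i - x j).

(* Main.v *)
(* A pair drawn at time k moves at most one of its two nodes, each with the same
   probability alpha, so the mean of sum_i x_i^2 decreases in one step by
   2 (alpha / n) T_k (1 - T_k) sum_ij a_ij (x_i - x_j)^2.  Connectedness bounds
   the last sum below by a multiple of H^2, and H never increases.  Hence the
   probability of [c <= H] at time k0 + m, times the sum of the T_k (1 - T_k)
   for k0 <= k < k0 + m, stays bounded in m; since that sum diverges the
   probability tends to 0, and monotonicity of H gives almost sure
   convergence. *)
Require Import Defs.
From HB Require Import structures.
From mathcomp Require Import all_boot all_order all_algebra.
From mathcomp Require Import all_classical all_reals all_analysis.
From mathcomp Require Import measurable_realfun.
From mathcomp Require Import ring lra.
Set Implicit Arguments. Unset Strict Implicit. Unset Printing Implicit Defensive.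
Import Order.TTheory GRing.Theory Num.Theory.
Local Open Scope classical_set_scope.
Local Open Scope ring_scope.

(** * Finite space of outcomes and the one-step law *)

Definition event_code (e : node_event) : option bool :=
  match e with EvA => Some true | EvN => Some false | EvR => None end.

Definition event_decode (b : option bool) : node_event :=
  match b with Some true => EvA | Some false => EvN | None => EvR end.

Lemma event_codeK : cancel event_code event_decode.
Proof. by case. Qed.

HB.instance Definition _ := Countable.copy node_event (can_type event_codeK).

Lemma event_enumP : Finite.axiom [:: EvA; EvN; EvR].
Proof. by case. Qed.

HB.instance Definition _ := fintype.isFinite.Build node_event event_enumP.

HB.instance Definition _ (n : nat) :=
  Finite.copy (outcome n) ('I_n * 'I_n * node_event * node_event)%type.

Lemma sum_event (V : nmodType) (F : node_event -> V) :
  \sum_e F e = F EvA + F EvN + F EvR.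
Proof.
by rewrite /index_enum unlock /= /reducebig /= /enum_mem unlock /= addr0 addrA.
Qed.

Lemma sum_outcome (R : pzSemiRingType) (n : nat) (F : outcome n -> R) :
  \sum_o F o = \sum_i \sum_j \sum_ei \sum_ej F (i, j, ei, ej).
Proof. by rewrite !pair_bigA; apply: eq_bigr => -[[[i j] ei] ej] _. Qed.

(** The shape that A2 and A4 force on the joint law of the two events: no repulsion, and at most one
    attraction per pair. *)
Definition one_sided_law (R : realType) (alpha : R)
    (q : node_event -> node_event -> R) : Prop :=
  [/\ q EvA EvA = 0, q EvA EvN = alpha, q EvN EvA = alpha,
      q EvN EvN = 1 - alpha *+ 2 & forall e, q EvR e = 0 /\ q e EvR = 0].

Definition repulsive (n : nat) (o : outcome n) : bool :=
  let: (_, _, ei, ej) := o in (ei == EvR) || (ej == EvR).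

Section Law.
Context (R : realType) (n : nat) (a : 'M[R]_n) (alpha : R).
Context (q : node_event -> node_event -> R).
Context (n0 : (0 < n)%N) (sa : stochastic a) (hq : one_sided_law alpha q).

Lemma step_law_ge0 o : (forall e1 e2, 0 <= q e1 e2) -> 0 <= step_law a q o.
Proof.
case: o => [[[i j] ei] ej] q0 /=; have [a0 _] := sa.
by rewrite !mulr_ge0 // invr_ge0.
Qed.

Lemma step_law_repulsive o : repulsive o -> step_law a q o = 0.
Proof.
case: hq => _ _ _ _ qR; case: o => [[[i j] ei] ej] /= /orP[] /eqP ->.
  by rewrite (qR ej).1 mulr0.
by rewrite (qR ei).2 mulr0.
Qed.

(** Only three pairs of events can carry mass, so every one-step mean becomes an explicit sum over
    node pairs. *)
Lemma sum_step_lawM (F : outcome n -> R) :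
  \sum_o step_law a q o * F o = n%:R^-1 * \sum_i \sum_j a i j *
    (alpha * (F (i, j, EvA, EvN) + F (i, j, EvN, EvA))
     + (1 - alpha *+ 2) * F (i, j, EvN, EvN)).
Proof.
rewrite sum_outcome mulr_sumr; apply: eq_bigr => i _.
rewrite mulr_sumr; apply: eq_bigr => j _; rewrite !sum_event /=.
have [-> -> -> -> qR] := hq.
rewrite (qR EvA).1 (qR EvN).1 (qR EvR).1 (qR EvA).2 (qR EvN).2; ring.
Qed.

Lemma sum_step_law : \sum_o step_law a q o = 1.
Proof.
have [_ a1] := sa.
under eq_bigr do rewrite -[step_law _ _ _]mulr1.
rewrite (sum_step_lawM (fun=> 1)).
rewrite (eq_bigr (fun=> 1)) => [|i _].
  by rewrite sumr_const card_ord mulVf // pnatr_eq0 -lt0n.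
rewrite -[RHS](a1 i); apply: eq_bigr => j _; ring.
Qed.

End Law.

(** * Mean decrease of the energy *)

Definition energy (R : realType) (n : nat) (x : 'I_n -> R) : R :=
  \sum_i x i ^+ 2.

Definition dissipation (R : realType) (n : nat) (a : 'M[R]_n) (x : 'I_n -> R)
  : R := \sum_i \sum_j a i j * (x i - x j) ^+ 2.

Lemma energy_step (R : realType) (n : nat) (t s : R) (i j : 'I_n)
    (ei ej : node_event) (x : 'I_n -> R) :
  energy (gossip_step t s (i, j, ei, ej) x) = energy x
    + (node_update ei t s (x i) (x j) ^+ 2 - x i ^+ 2)
    + (node_update ej t s (x j) (x i) ^+ 2 - x j ^+ 2).
Proof.
rewrite /energy (bigD1 i) //= eqxx [in RHS](bigD1 i) //=.
(* A pair with [j = i] changes no state, whatever the events, and both corrections vanish. *)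
have [->|ij] := eqVneq j i.
  rewrite (eq_bigr (fun l => x l ^+ 2)); last by move=> l /negPf ->.
  by case: ei; case: ej => /=; ring.
rewrite (bigD1 j) //= (negPf ij) eqxx [in RHS](bigD1 j) //=.
rewrite (eq_bigr (fun l => x l ^+ 2)); first by ring.
by move=> l /andP[/negPf -> /negPf ->].
Qed.

(** The two attractions of a pair are equally likely, and their energy changes add up to
    [- 2 t (1 - t) (x i - x j)^2]; neither change alone has a sign. *)
Lemma mean_energy_step (R : realType) (n : nat) (a : 'M[R]_n) (alpha t s : R)
    (q : node_event -> node_event -> R) (x : 'I_n -> R) :
  (0 < n)%N -> stochastic a -> one_sided_law alpha q ->
  \sum_o step_law a q o * energy (gossip_step t s o x) =
  energy x - t * (1 - t) * (2 * alpha / n%:R * dissipation a x).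
Proof.
move=> n0 sa hq; rewrite (sum_step_lawM a hq).
(* The weights [a i j / n] sum to 1; spreading [energy x] over them lets the identity be checked
   pair by pair. *)
have -> : energy x = n%:R^-1 * \sum_i \sum_j a i j * energy x.
  under eq_bigr do rewrite -mulr_suml sa.2 mul1r.
  by rewrite sumr_const card_ord -[energy x *+ n]mulr_natl mulrA mulVf ?mul1r //
    pnatr_eq0 -lt0n.
set c := t * (1 - t).
have -> : c * (2 * alpha / n%:R * dissipation a x) =
    n%:R^-1 * \sum_i \sum_j a i j * (c * 2 * alpha * (x i - x j) ^+ 2).
  rewrite /dissipation [2 * alpha / _]mulrC !mulrA [c * _]mulrC -!mulrA; congr (_ * _).
  rewrite !mulr_sumr; apply: eq_bigr => i _.
  rewrite !mulr_sumr; apply: eq_bigr => j _; ring.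
rewrite -mulrBr -sumrB; congr (_ * _); apply: eq_bigr => i _.
rewrite -sumrB; apply: eq_bigr => j _; rewrite !energy_step /= /c; ring.
Qed.

(** * The gap: monotonicity and control by the dissipation *)

Lemma Hgap_ge (R : realType) (n : nat) (x : 'I_n -> R) i j :
  x i - x j <= Hgap x.
Proof.
rewrite /Hgap; apply: le_trans (le_bigmax _ _ i).
exact: (le_bigmax _ (fun j => x i - x j) j).
Qed.

Lemma Hgap_ge0 (R : realType) (n : nat) (x : 'I_n -> R) : 0 <= Hgap x.
Proof. exact: bigmax_ge_id. Qed.

Lemma Hgap_le (R : realType) (n : nat) (x : 'I_n -> R) h :
  0 <= h -> (forall i j, x i - x j <= h) -> Hgap x <= h.
Proof. by move=> h0 xh; apply: bigmax_le => // i _; apply: bigmax_le. Qed.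

Lemma node_update_le (R : realType) (e : node_event) (t s u v b : R) :
  0 <= t <= 1 -> e != EvR -> u <= b -> v <= b -> node_update e t s u v <= b.
Proof. by case: e => //= /andP[t0 t1] _ ub vb; nra. Qed.

Lemma node_update_ge (R : realType) (e : node_event) (t s u v b : R) :
  0 <= t <= 1 -> e != EvR -> b <= u -> b <= v -> b <= node_update e t s u v.
Proof. by case: e => //= /andP[t0 t1] _ ub vb; nra. Qed.

(** Without repulsion the new values are convex combinations of old ones. *)
Lemma Hgap_step (R : realType) (n : nat) (t s : R) (o : outcome n)
    (x : 'I_n -> R) :
  0 <= t <= 1 -> ~~ repulsive o -> Hgap (gossip_step t s o x) <= Hgap x.
Proof.
case: o => [[[i j] ei] ej] t01 /=; rewrite negb_or => /andP[ei0 ej0].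
set y := fun l => _; apply: Hgap_le => [|k l]; first exact: Hgap_ge0.
(* The two indices are treated in turn: first a new value against an old one, then new against
   new. *)
have yx m : y k - x m <= Hgap x.
  rewrite lerBlDr /y; have H r : x r <= Hgap x + x m.
    by rewrite -lerBlDr Hgap_ge.
  by do 2?case: ifP => _ //; exact: node_update_le.
have H r : y k - Hgap x <= x r by rewrite lerBlDr -lerBlDl.
rewrite lerBlDr -lerBlDl {2}/y.
by do 2?case: ifP => _ //; exact: node_update_ge.
Qed.

(** The difference [x i - x j] telescopes along an undirected path of edges, and each edge of
    positive weight is controlled by its own term of the dissipation. The constant depends on [a]
    only. *)
Lemma Hgap_dissipation (R : realType) (n : nat) (a : 'M[R]_n) :
  stochastic a -> weakly_connected a ->
  exists2 C : R, 0 < C &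
    forall x : 'I_n -> R, Hgap x ^+ 2 <= C * dissipation a x.
Proof.
move=> [a0 _] conn.
have D0 (x : 'I_n -> R) : 0 <= dissipation a x.
  by apply: sumr_ge0 => i _; apply: sumr_ge0 => j _; rewrite mulr_ge0 ?sqr_ge0.
have edge (x : 'I_n -> R) i j : a i j * (x i - x j) ^+ 2 <= dissipation a x.
  rewrite /dissipation (bigD1 i) //= (bigD1 j) //= -addrA lerDl addr_ge0 //.
    by apply: sumr_ge0 => l _; rewrite mulr_ge0 ?sqr_ge0.
  apply: sumr_ge0 => k _; apply: sumr_ge0 => l _.
  by rewrite mulr_ge0 ?sqr_ge0.
(* Adding both inverses covers either orientation of the edge; for a missing arc the inverse is
   [0^-1 = 0]. *)
have edge' (x : 'I_n -> R) i j : (0 < a i j) || (0 < a j i) ->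
    (x i - x j) ^+ 2 <= ((a i j)^-1 + (a j i)^-1) * dissipation a x.
  case/orP => aij.
    apply: (@le_trans _ _ ((a i j)^-1 * dissipation a x)).
      by rewrite mulrC ler_pdivlMr // mulrC.
    by rewrite ler_wpM2r // lerDl invr_ge0.
  apply: (@le_trans _ _ ((a j i)^-1 * dissipation a x)).
    by rewrite mulrC ler_pdivlMr // mulrC -(opprB (x j)) sqrrN.
  by rewrite ler_wpM2r // lerDr invr_ge0.
have pair i j : exists C : R, 0 <= C /\
    forall x : 'I_n -> R, (x i - x j) ^+ 2 <= C * dissipation a x.
  have /connectP[p] := conn i j.
  elim: p i => [|k p IH] i /=.
    by move=> _ ->; exists 0; split=> // x; rewrite subrr expr0n mul0r.
  case/andP => ik pp jl; have [C [C0 HC]] := IH k pp jl.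
  (* From [(u + v)^2 <= 2 u^2 + 2 v^2], with the edge to [k] and the rest of the path. *)
  exists (((a i k)^-1 + (a k i)^-1) * 2 + C * 2); split.
    by rewrite addr_ge0 ?mulr_ge0 ?addr_ge0 ?invr_ge0.
  move=> x; have := HC x; have := edge' x i k ik.
  set D := dissipation a x; set b := _^-1 + _^-1 => h1 h2.
  have h3 : (x i - x j) ^+ 2 <= 2 * (x i - x k) ^+ 2 + 2 * (x k - x j) ^+ 2.
    rewrite -subr_ge0.
    rewrite (_ : _ - _ = (x i - x k - (x k - x j)) ^+ 2) ?sqr_ge0 //; ring.
  apply: le_trans h3 _; rewrite (mulrDl (b * 2) (C * 2) D).
  rewrite -(mulrA b) -(mulrA C) (mulrCA b) (mulrCA C).
  by rewrite lerD // ler_pM2l.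
have pair2 (ij : 'I_n * 'I_n) : exists C : R, 0 <= C /\
    forall x : 'I_n -> R, (x ij.1 - x ij.2) ^+ 2 <= C * dissipation a x.
  exact: pair.
have [C HC] := fin_all_exists pair2.
have S0 : 0 <= \sum_ij C ij by apply: sumr_ge0 => ij _; exact: (HC ij).1.
(* The sum dominates the constant of every pair; the 1 makes it positive. *)
exists (1 + \sum_ij C ij) => [|x]; first by rewrite ltr_pwDl.
rewrite -[leRHS]sqr_sqrtr; last by rewrite mulr_ge0 // addr_ge0.
rewrite lerXn2r ?nnegrE ?Hgap_ge0 ?sqrtr_ge0 //.
apply: Hgap_le => [|i j]; first exact: sqrtr_ge0.
apply: le_trans (ler_norm _) _; rewrite -sqrtr_sqr ler_wsqrtr //.
apply: le_trans ((HC (i, j)).2 x) _; rewrite ler_wpM2r //.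
rewrite (bigD1 (i, j)) //= addrCA lerDl addr_ge0 //.
by apply: sumr_ge0 => ij _; exact: (HC ij).1.
Qed.

(** * Cylinder events of the independent draws *)

Definition cylinder (Omega O : Type) (X : nat -> Omega -> O) (N : nat)
  (o : nat -> O) : set Omega := [set w | forall k, (k < N)%N -> X k w = o k].

Lemma cylinderS (Omega O : Type) (X : nat -> Omega -> O) N o :
  cylinder X N.+1 o = cylinder X N o `&` [set w | X N w = o N].
Proof.
apply/seteqP; split => w /=; rewrite /cylinder /=.
  by move=> H; split=> [k kN|]; apply: H => //; exact: ltnW.
move=> [H HN] k; rewrite ltnS leq_eqVlt => /predU1P[->//|]; exact: H.
Qed.

Lemma eq_cylinder (Omega O : Type) (X : nat -> Omega -> O) N (o o' : nat -> O) :
  (forall k, (k < N)%N -> o k = o' k) -> cylinder X N o = cylinder X N o'.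
Proof.
move=> oo'; apply/seteqP.
by split => w /= H k kN; rewrite H // oo'.
Qed.

Lemma measurable_cylinder (R : realType) (O : finType) (d : measure_display)
    (Omega : measurableType d) (P : probability Omega R) (p : O -> R)
    (X : nat -> Omega -> O) N o :
  iid_seq P p X -> measurable (cylinder X N o).
Proof.
move=> [mX _]; elim: N => [|N IH]; last by rewrite cylinderS; exact: measurableI.
by rewrite (_ : cylinder _ _ _ = setT) //; apply/seteqP; split.
Qed.

Lemma prob_split (R : realType) (O : finType) (d : measure_display)
    (Omega : measurableType d) (P : probability Omega R) (p : O -> R)
    (X : nat -> Omega -> O) k (B : set Omega) :
  iid_seq P p X -> measurable B ->
  P B = (\sum_(o : O) P (B `&` [set w | X k w = o]))%E.
Proof.
move=> [mX _] mB.
rewrite fsbig_seq ?index_enum_uniq // -measure_fin_bigcup //.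
- congr (P _); apply/seteqP; split => [w Bw|w [e _ [Bw _]]//].
  by exists (X k w) => //=; exact: mem_index_enum.
- by move=> o o' _ _ [w [[_ <-] [_ <-]]].
- by move=> o _; exact: measurableI.
Qed.

(** Summing over the last draw removes it, since [p] has total mass 1; after [N] removals the
    cylinder is the whole space. *)
Lemma cylinder_total (R : realType) (O : finType) (d : measure_display)
    (Omega : measurableType d) (P : probability Omega R) (p : O -> R)
    (X : nat -> Omega -> O) (B : set Omega) N (v : R) :
  iid_seq P p X -> \sum_o p o = 1 -> measurable B ->
  (forall o, P (cylinder X N o `&` B) = (\prod_(k < N) p (o k) * v)%:E) ->
  P B = v%:E.
Proof.
move=> iX p1 mB; elim: N => [|N IH] H.
  (* [O] is not assumed inhabited, so a sequence of outcomes is read off at the default point of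
     [Omega]. *)
  have w0 : Omega := point.
  have := H (X ^~ w0); rewrite big_ord0 mul1r (_ : cylinder _ _ _ = setT) ?setTI //.
  by apply/seteqP; split.
apply: IH => o; rewrite (prob_split N iX); last first.
  by apply: measurableI => //; exact: measurable_cylinder iX.
pose upd e k := if k == N then e else o k.
rewrite (eq_bigr (fun e => (\prod_(k < N) p (o k) * v * p e)%:E)).
  by rewrite sumEFin -mulr_sumr p1 mulr1.
move=> e _; rewrite setIAC (_ : cylinder _ _ _ `&` _ = cylinder X N.+1 (upd e)); last first.
  rewrite cylinderS /upd eqxx; congr (_ `&` _); apply: eq_cylinder => k kN.
  by rewrite ltn_eqF.
rewrite H big_ord_recr /= {2}/upd eqxx mulrAC; congr (_ * _ * _)%:E.
by apply: eq_bigr => k _; rewrite /upd ltn_eqF.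
Qed.

Lemma prob_marginal (R : realType) (O : finType) (d : measure_display)
    (Omega : measurableType d) (P : probability Omega R) (p : O -> R)
    (X : nat -> Omega -> O) k o :
  iid_seq P p X -> \sum_o p o = 1 -> P [set w | X k w = o] = (p o)%:E.
Proof.
move=> iX p1; have [mX law] := iX.
apply: (@cylinder_total _ _ _ _ _ p X _ k) => // u.
pose u' i := if i == k then o else u i.
rewrite (_ : _ `&` _ = cylinder X k.+1 u'); last first.
  rewrite cylinderS /u' eqxx; congr (_ `&` _); apply: eq_cylinder => i ik.
  by rewrite ltn_eqF.
rewrite /cylinder law big_ord_recr /= {2}/u' eqxx; congr (_ * _)%:E.
by apply: eq_bigr => i _; rewrite /u' ltn_eqF.
Qed.

(** * Law of the trajectory *)

(* [hit_prob p T S Q m k x] is the probability that the state satisfies [Q]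
   after [m] steps started at time [k] from [x], computed by conditioning on
   the first step. *)
Fixpoint hit_prob (R : realType) (n : nat) (p : outcome n -> R)
    (T S : nat -> R) (Q : pred ('I_n -> R)) (m k : nat) (x : 'I_n -> R) : R :=
  if m is m'.+1 then
    \sum_o p o * hit_prob p T S Q m' k.+1 (gossip_step (T k) (S k) o x)
  else (Q x)%:R.

(** [traj] recurses on its last step, [hit_prob] on its first; this peels off the first step. *)
Lemma trajS (R : realType) (n : nat) (T S : nat -> R) (Omega : Type)
    (X : nat -> Omega -> outcome n) k x m w :
  traj T S X k x m.+1 w =
  traj T S X k.+1 (gossip_step (T k) (S k) (X k w) x) m w.
Proof.
elim: m => [|m IH]; first by rewrite /= addn0.
by rewrite [LHS]/= -/(traj T S X k x m.+1 w) IH /= addSnnS.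
Qed.

Lemma traj_cond (R : realType) (n : nat) (T S : nat -> R) (Omega : Type)
    (X : nat -> Omega -> outcome n) (Q : pred ('I_n -> R)) k x m o :
  [set w | Q (traj T S X k x m.+1 w)] `&` [set w | X k w = o] =
  [set w | X k w = o] `&`
    [set w | Q (traj T S X k.+1 (gossip_step (T k) (S k) o x) m w)].
Proof.
apply/seteqP; split => w /= [].
  by move=> + <-; rewrite -trajS.
by move=> <-; rewrite -trajS.
Qed.

Lemma measurable_traj (R : realType) (n : nat) (T S : nat -> R)
    (d : measure_display) (Omega : measurableType d)
    (X : nat -> Omega -> outcome n) (Q : pred ('I_n -> R)) k x m :
  (forall k o, measurable [set w | X k w = o]) ->
  measurable [set w | Q (traj T S X k x m w)].
Proof.
move=> mX; elim: m k x => [|m IH] k x.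
  rewrite /=; case: (Q x).
    by rewrite (_ : mkset _ = setT) //; apply/seteqP; split.
  by rewrite (_ : mkset _ = set0) //; apply/seteqP; split.
set A := (X in measurable X).
rewrite (_ : A = \bigcup_(o in setT) (A `&` [set w | X k w = o])).
  by apply: fin_bigcup_measurable => // o _; rewrite traj_cond; apply: measurableI.
apply/seteqP; split => [w Aw|w [e _ [Bw _]]//]; by exists (X k w).
Qed.

(** Markov property: what happens from time [N] on is independent of the first [N] draws. In the
    induction on [m] the next draw is absorbed into the cylinder. *)
Lemma prob_cylinder_traj (R : realType) (n : nat) (p : outcome n -> R)
    (T S : nat -> R) (d : measure_display) (Omega : measurableType d)
    (P : probability Omega R) (X : nat -> Omega -> outcome n)
    (Q : pred ('I_n -> R)) N o x m :
  iid_seq P p X ->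
  P (cylinder X N o `&` [set w | Q (traj T S X N x m w)]) =
  (\prod_(k < N) p (o k) * hit_prob p T S Q m N x)%:E.
Proof.
move=> iX; have [mX law] := iX; elim: m N o x => [|m IH] N o x.
  rewrite /=; case: (Q x).
    rewrite (_ : [set _ | _] = setT); last by apply/seteqP; split.
    by rewrite setIT mulr1; exact: law.
  rewrite (_ : [set _ | _] = set0); last by apply/seteqP; split.
  by rewrite setI0 mulr0 measure0.
rewrite (prob_split N iX); last first.
  by apply: measurableI; [exact: measurable_cylinder iX|exact: measurable_traj].
rewrite /= mulr_sumr -sumEFin; apply: eq_bigr => e _.
pose upd k := if k == N then e else o k.
rewrite -setIA (traj_cond T S X Q N x m e) setIA.
rewrite (_ : cylinder _ _ _ `&` _ = cylinder X N.+1 upd); last first.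
  rewrite cylinderS /upd eqxx; congr (_ `&` _); apply: eq_cylinder => k kN.
  by rewrite ltn_eqF.
rewrite IH big_ord_recr /= {2}/upd eqxx mulrA; congr (_ * _ * _)%:E.
by apply: eq_bigr => k _; rewrite /upd ltn_eqF.
Qed.

Lemma prob_traj (R : realType) (n : nat) (p : outcome n -> R)
    (T S : nat -> R) (d : measure_display) (Omega : measurableType d)
    (P : probability Omega R) (X : nat -> Omega -> outcome n)
    (Q : pred ('I_n -> R)) k x m :
  iid_seq P p X -> \sum_o p o = 1 ->
  P [set w | Q (traj T S X k x m w)] = (hit_prob p T S Q m k x)%:E.
Proof.
move=> iX p1; apply: (cylinder_total (N := k) iX p1) => [|o].
  by apply: measurable_traj; case: iX.
exact: prob_cylinder_traj.
Qed.

(** * Probability that the gap stays large *)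

(** Repulsive draws have weight 0 and the others do not increase the gap, so [c <= Hgap] can hold
    later only if it holds at the start. *)
Lemma sqr_Hgap_hit_prob (R : realType) (n : nat) (p : outcome n -> R)
    (T S : nat -> R) (c : R) m k x :
  (forall o, 0 <= p o) -> (forall o, repulsive o -> p o = 0) ->
  \sum_o p o = 1 -> (forall k, 0 <= T k <= 1) -> 0 <= c ->
  c ^+ 2 * hit_prob p T S (fun y => c <= Hgap y) m k x <= Hgap x ^+ 2.
Proof.
move=> p0 pR p1 T01 c0; elim: m k x => [|m IH] k x /=.
  have [cH|_] := boolP (c <= Hgap x); last by rewrite mulr0 sqr_ge0.
  by rewrite mulr1 lerXn2r ?nnegrE // Hgap_ge0.
rewrite mulr_sumr -[leRHS]mul1r -p1 mulr_suml; apply: ler_sum => o _.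
rewrite mulrCA; have [/pR->|oR] := boolP (repulsive o); first by rewrite !mul0r.
rewrite ler_wpM2l // (le_trans (IH _ _)) //.
by rewrite lerXn2r ?nnegrE ?Hgap_ge0 ?Hgap_step.
Qed.

(* The mean energy lost up to time [m] is at least [b c^2] times the sum of the
   [T (1 - T)] times the probability of [c <= H] at time [m], as that event only
   shrinks with time. *)
Lemma energy_hit_prob (R : realType) (n : nat) (p : outcome n -> R)
    (T S : nat -> R) (b c : R) m k x :
  (forall o, 0 <= p o) -> (forall o, repulsive o -> p o = 0) ->
  \sum_o p o = 1 -> (forall k, 0 <= T k <= 1) -> 0 <= c -> 0 <= b ->
  (forall k x, \sum_o p o * energy (gossip_step (T k) (S k) o x) <=
    energy x - T k * (1 - T k) * (b * Hgap x ^+ 2)) ->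
  b * c ^+ 2 * (\sum_(i < m) T (k + i)%N * (1 - T (k + i)%N)) *
    hit_prob p T S (fun y => c <= Hgap y) m k x <= energy x.
Proof.
move=> p0 pR p1 T01 c0 b0 dec; elim: m k x => [|m IH] k x.
  by rewrite big_ord0 mulr0 mul0r; apply: sumr_ge0 => i _; exact: sqr_ge0.
have t0 : 0 <= T k * (1 - T k).
  by case/andP: (T01 k) => ? ?; rewrite mulr_ge0 // subr_ge0.
have H1 := sqr_Hgap_hit_prob S m.+1 k x p0 pR p1 T01 c0.
(* The term [i = 0] is paid for by the energy lost in the first step, the remaining terms by
   induction from the state after it. *)
rewrite big_ord_recl addn0 mulrDr mulrDl -[leRHS](subrK (T k * (1 - T k) * (b * Hgap x ^+ 2))).
rewrite addrC; apply: lerD.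
  apply: le_trans (dec k x); rewrite /= mulr_sumr; apply: ler_sum => o _.
  rewrite mulrCA ler_wpM2l //; apply: le_trans (IH _ _).
  by under eq_bigr do rewrite -addSnnS.
rewrite (_ : _ * _ * _ * _ = T k * (1 - T k) *
  (b * (c ^+ 2 * hit_prob p T S (fun y => c <= Hgap y) m.+1 k x))); last by ring.
by rewrite !ler_wpM2l.
Qed.

(** * Series and limits of real sequences *)

Lemma sum_tail_unbounded (R : realType) (u v : nat -> R) (k0 : nat) (M : R) :
  (forall k, u k <= v k) -> (fun N => \sum_(k < N) u k) @ \oo --> +oo ->
  exists m, M <= \sum_(i < m) v (k0 + i)%N.
Proof.
move=> uv /cvgryPge /(_ (M + \sum_(k < k0) u k)) [N _ HN].
exists N; have := HN (k0 + N)%N (leq_addl _ _).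
rewrite /= big_split_ord /= [leRHS]addrC lerD2r => /le_trans; apply.
exact: ler_sum.
Qed.

(** Only countably many thresholds occur, so almost sure convergence reduces to countably many null
    sets. *)
Lemma limn_esup_eq0 (R : realType) (u : nat -> R) :
  (forall m, 0 <= u m) -> (forall m, u m.+1 <= u m) ->
  (forall j, exists m, u m < j.+1%:R^-1) ->
  limn_esup (fun m => (u m)%:E) = 0%E.
Proof.
move=> u0 uS small; apply: (cvg_limn_einf_sup _).2.
apply: cvg_EFin; first by near=> m.
apply/cvgrPdist_le => e e0.
(* With [j] the integer part of [1 / e], [1 / (j + 1) < e]. *)
have [m um] := small (Num.truncn e^-1); near=> k.
rewrite sub0r normrN ger0_norm //.
have mk : (m <= k)%N by near: k; exact: nbhs_infty_ge.
apply: le_trans (_ : u m <= _).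
  by move/nonincreasing_seqP: uS; apply.
apply/ltW/(lt_trans um); rewrite invf_plt ?posrE //.
exact: truncnS_gt.
Unshelve. all: by end_near.
Qed.

(** Turns divergence of the series of powers into divergence of the sum of [T (1 - T)]; a number in
    [0, 1] dominates its positive powers. *)
Lemma expr_onem_mul_le (R : realDomainType) (t : R) (m : nat) :
  0 <= t <= 1 -> (0 < m)%N -> ((1 - t) * t) ^+ m <= t * (1 - t).
Proof.
case: m => // m /andP[t0 t1] _; rewrite exprS mulrC [t * _]mulrC.
by rewrite ler_piMl ?exprn_ile1 ?mulr_ge0 ?subr_ge0 //; nra.
Qed.

(** * Almost sure convergence of the gap *)

Theorem theorem4 (R : realType) (n : nat) (a : 'M[R]_n)
  (alpha beta gamma : R) (q : node_event -> node_event -> R)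
  (T S : nat -> R)
  (d : measure_display) (Omega : measurableType d) (P : probability Omega R)
  (X : nat -> Omega -> outcome n) :
  (3 <= n)%N ->
  stochastic a ->
  (* probabilities of the node events *)
  0 <= alpha -> 0 <= beta -> 0 <= gamma -> alpha + beta + gamma = 1 ->
  0 < alpha ->
  (forall e1 e2, 0 <= q e1 e2) ->
  q EvA EvA + q EvA EvN + q EvA EvR = alpha ->
  q EvN EvA + q EvN EvN + q EvN EvR = beta ->
  q EvR EvA + q EvR EvN + q EvR EvR = gamma ->
  q EvA EvA + q EvN EvA + q EvR EvA = alpha ->
  q EvA EvN + q EvN EvN + q EvR EvN = beta ->
  q EvA EvR + q EvN EvR + q EvR EvR = gamma ->
  (* step sizes *)
  (forall k, 0 < T k <= 1) -> (forall k, 0 < S k) ->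
  (* the random draws are i.i.d. with the law of the model *)
  iid_seq P (step_law a q) X ->
  (* A1 *) weakly_connected a ->
  (* A2 *) gamma = 0 ->
  (* A4 *) q EvA EvA = 0 ->
  ((forall k, T k.+1 <= T k) \/ (forall k, T k <= T k.+1)) ->
  (fun N => \sum_(k < N) ((1 - T k) * T k) ^+ n.-1) @ \oo --> +oo ->
  forall (k0 : nat) (x0 : 'I_n -> R),
    P [set w : Omega | limn_esup (fun m => (Hgap (traj T S X k0 x0 m w))%:E) = 0%E] = 1%E.
Proof.
move=> n3 sa _ _ _ abg alpha0 q0 qA qN qR qA' qN' qR' T01 _ iX conn gamma0 qAA _ div k0 x0.
have n0 : (0 < n)%N by exact: leq_trans n3.
have hq : one_sided_law alpha q.
  (* Nonnegative entries with zero sum vanish, which clears the row and column of [EvR]; then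
     [q EvN EvN = beta - alpha = 1 - 2 alpha]. *)
  have := q0; rewrite gamma0 in qR qR' => qq.
  have [] := (qq EvR EvA, qq EvR EvN); have [] := (qq EvR EvR, qq EvA EvR).
  have := qq EvN EvR => *; split; try lra.
  by case; split; lra.
have T01' k : 0 <= T k <= 1 by case/andP: (T01 k) => /ltW -> ->.
have p0 o : 0 <= step_law a q o by exact: step_law_ge0.
have p1 := sum_step_law n0 sa hq.
have pR o := @step_law_repulsive _ _ a _ _ hq o.
have mX : forall k o, measurable [set w | X k w = o] by case: iX.
have [C C0 HC] := Hgap_dissipation sa conn.
(* The factor [2 alpha / n] of the mean energy loss, divided by [C] to pass from the dissipation to
   the squared gap. *)
pose b := 2 * alpha / n%:R / C.
have b0 : 0 < b by rewrite !divr_gt0 ?mulr_gt0 ?ltr0n.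
have dec k x : \sum_o step_law a q o * energy (gossip_step (T k) (S k) o x) <=
    energy x - T k * (1 - T k) * (b * Hgap x ^+ 2).
  rewrite (mean_energy_step _ _ _ n0 sa hq) lerB // ler_wpM2l //.
    by case/andP: (T01' k) => ? ?; rewrite mulr_ge0 // subr_ge0.
  rewrite /b -mulrA ler_wpM2l //; first by rewrite divr_ge0 // mulr_ge0 // ltW.
  by rewrite mulrC ler_pdivrMr // mulrC.
pose H m w := Hgap (traj T S X k0 x0 m w).
have mH m (Q : pred R) : measurable [set w | Q (H m w)].
  exact: (measurable_traj T S (fun x => Q (Hgap x))).
have mL : measurable [set w | limn_esup (fun m => (H m w)%:E) = 0%E].
  have : measurable_fun setT (fun w => limn_esup (fun m => (H m w)%:E)).
    apply: measurable_fun_limn_esup => m.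
    apply/measurable_EFinP => _ Y mY; rewrite setTI.
    rewrite (_ : _ @^-1` _ = [set w | (fun y => `[< Y y >]) (H m w)]).
      exact: mH m (fun y => `[< Y y >]).
    by apply/seteqP; split => w /= /asboolP.
  by move=> /(_ measurableT [set 0%E] (emeasurable_set1 _)); rewrite setTI.
(* Almost surely the gap falls below [c] at some time. *)
have null_hit (c : R) : 0 < c -> P.-negligible (\bigcap_m [set w | c <= H m w]).
  move=> c0; apply/negligibleP.
    by apply: bigcap_measurableType => m _; exact: (mH m (fun y => c <= y)).
  apply/eqP; rewrite -measure_le0; apply/lee_addgt0Pr => e e0; rewrite add0e.
  have uv k : ((1 - T k) * T k) ^+ n.-1 <= T k * (1 - T k).
    by apply: expr_onem_mul_le => //; rewrite -ltnS prednK // ltnW.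
  (* Chosen so that a probability above [e] at step [m] would need energy at least
     [energy x0 + 1]. *)
  have [m Hm] := sum_tail_unbounded k0 ((energy x0 + 1) / (b * c ^+ 2 * e)) uv div.
  apply: (@le_trans _ _ (P [set w | c <= H m w])).
    apply: le_measure; rewrite ?inE.
    - by apply: bigcap_measurableType => k _; exact: (mH k (fun y => c <= y)).
    - exact: (mH m (fun y => c <= y)).
    - by move=> w; apply.
  rewrite (prob_traj T S (fun y => c <= Hgap y) k0 x0 m iX p1) lee_fin leNgt.
  apply/negP => eh.
  have := energy_hit_prob m k0 x0 p0 pR p1 T01' (ltW c0) (ltW b0) dec.
  set s := \sum_(_ < _) _ in Hm *; set h := hit_prob _ _ _ _ _ _ _ in eh *.
  have bc0 : 0 < b * c ^+ 2 by rewrite mulr_gt0 // exprn_gt0.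
  have s0 : 0 <= s.
    apply: sumr_ge0 => i _; case/andP: (T01' (k0 + i)%N) => ? ?.
    by rewrite mulr_ge0 // subr_ge0.
  apply/negP; rewrite -ltNge.
  move: Hm; rewrite ler_pdivrMr ?(mulr_gt0 bc0 e0) // => Hm.
  apply: lt_le_trans (le_trans Hm _); first by rewrite ltrDl.
  by rewrite mulrA [s * _]mulrC ler_wpM2l ?(mulr_ge0 (ltW bc0) s0) ?(ltW eh).
(* The complement is covered by two null sets: some draw is repulsive, or the gap stays above some
   [1 / (j + 1)]. Off the first set the gap is nonincreasing along the sample. *)
rewrite -[X in P X]setCK probability_setC; last exact: measurableC.
rewrite (measure_negligible (measurableC mL)) ?sube0 //.
have null_rep : P.-negligible (\bigcup_k \big[setU/set0]_(o | repulsive o)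
    [set w | X k w = o]).
  apply: negligible_bigcup => k; elim/big_ind: _ => [||o oR].
  - exact: negligible_set0.
  - exact: negligibleU.
  - apply/negligibleP; first exact: mX.
    by apply: etrans (prob_marginal k o iX p1) _; rewrite pR.
have null_gap : P.-negligible
    (\bigcup_j \bigcap_m [set w | j.+1%:R^-1 <= H m w]).
  by apply: negligible_bigcup => j; apply: null_hit; rewrite invr_gt0.
apply: negligibleS (negligibleU null_rep null_gap) => w /= Lw.
apply: contrapT => /not_orP[nrep ngap]; apply: Lw.
apply: limn_esup_eq0 => [m|m|j]; first exact: Hgap_ge0.
- apply: Hgap_step => //; apply/negP => rep; apply: nrep.
  by exists (k0 + m)%N => //; rewrite (bigD1 (X (k0 + m)%N w)) //=; left.
- apply: contrapT => /forallNP hj; apply: ngap; exists j => // m _ /=.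
  by rewrite leNgt; apply/negP; exact: hj.
Qed.
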